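(* Let $\mathbb K$ be a field of characteristic zero and let $\sqcup\!\sqcup$ denote the shuffle product on $\mathbb K\langle\mathscr A\rangle$. Write $\widetilde{\mathcal P}_i(\cdot;t)=\widetilde{\mathcal P}_i(\alpha_1,\dots,\alpha_i;t)$ and $\mathcal P_i=\mathcal P_i(\alpha_1,\dots,\alpha_i)$. Then for all $i\in\mathbb N$ the following hold. (A) For all $t\in\mathbb K$, $t\ne-1$, $$\widetilde{\mathcal P}_i(\cdot;t)=\frac{t-i+1}{t+1}\cdot\sum_{j=1}^{i+1}j\,\mathcal P_{j-1}\sqcup\!\sqcup\,\widetilde{\mathcal P}_{i-j+1}(\cdot;t-j).$$ (B) For all $t\in\mathbb K$, $$\widetilde{\mathcal P}_i(\cdot;t)=\sum_{j=1}^i\left(\frac{(t-i+2)j}{i}-1\right)\mathcal P_j\sqcup\!\sqcup\,\widetilde{\mathcal P}_{i-j}(\cdot;t-j).$$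
   Context: $\mathscr A=\{\alpha_i:i\in\mathbb N\}$ is a countable alphabet and $\mathbb K\langle\mathscr A\rangle$ is the $\mathbb K$-vector space with basis all words in $\mathscr A$ (including the empty word $1$), made into a commutative unital algebra by the shuffle product: $\alpha_{i_1}\cdots\alpha_{i_r}\sqcup\!\sqcup\,\alpha_{i_{r+1}}\cdots\alpha_{i_{r+s}}=\sum_\sigma\alpha_{i_{\sigma(1)}}\cdots\alpha_{i_{\sigma(r+s)}}$ over permutations $\sigma$ of $\{1,\dots,r+s\}$ with $\sigma^{-1}(1)<\cdots<\sigma^{-1}(r)$ and $\sigma^{-1}(r+1)<\cdots<\sigma^{-1}(r+s)$. Generalized displacement polynomials: $\widetilde{\mathcal P}_0:=1$ and, for $i\in\mathbb N$, $\widetilde{\mathcal P}_i(\alpha_1,\dots,\alpha_i;t)=\sum_{i_1+\cdots+i_k=i}p_{i_1,\dots,i_k}(t)\,\alpha_{i_k}\cdots\alpha_{i_1}$ (letters multiplied by concatenation), where the sum runs over all $k\in\{1,\dots,i\}$ and all $(i_1,\dots,i_k)\in\mathbb N^k$ with sum $i$, and $p_{i_1,\dots,i_k}(t)=(t-i_1+1)(t-i_1-i_2+1)\cdots(t-i_1-\cdots-i_k+1)$. Displacement polynomials: $\mathcal P_0:=1$, $\mathcal P_i(\alpha_1,\dots,\alpha_i):=\widetilde{\mathcal P}_i(\alpha_1,\dots,\alpha_i;i)$. *)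

(* Defs.v *)
From HB Require Import structures.
From mathcomp Require Import all_boot all_order all_fingroup all_algebra.
From mathcomp Require Import finmap monalg.

Set Implicit Arguments.
Unset Strict Implicit.
Unset Printing Implicit Defensive.

Import GRing.Theory.
Local Open Scope ring_scope.

(* The alphabet is indexed by the positive integers: the natural number [n]
   encodes the letter alpha_(n+1). *)
Definition word := seq nat.

(* A permutation s of the r + q positions such that s^-1 is increasing on the
   first r positions and on the remaining q positions (0-based). *)
Definition is_shuffle (r q : nat) (s : 'S_(r + q)) : bool :=
  [forall x : 'I_(r + q), forall y : 'I_(r + q),
     ((x < y < r)%N || (r <= x < y)%N) ==> ((s^-1)%g x < (s^-1)%g y)%N].

Definition shuffle_word (K : fieldType) (u v : word) : {malg K[word]} :=
  \sum_(s : 'S_(size u + size v) | is_shuffle s)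
     << [seq nth 0%N (u ++ v) (s k) | k : 'I_(size u + size v)] >>.

(* [{malg K[word]}] is only the free K-module on the words; the shuffle product
   is the bilinear extension of [shuffle_word]. *)
Definition shuffle (K : fieldType) (f g : {malg K[word]}) : {malg K[word]} :=
  \sum_(u <- msupp f) \sum_(v <- msupp g)
     (f@_u * g@_v) *: shuffle_word K u v.

Notation "f ⧢ g" := (shuffle f g) (at level 40, left associativity).

(* p_{i_1,...,i_k}(t) for the sequence of parts [:: i_1; ...; i_k]. *)
Definition p_coef (K : fieldType) (parts : seq nat) (t : K) : K :=
  \prod_(1 <= m < (size parts).+1) (t - (sumn (take m parts))%:R + 1).

(* A tuple [c : k.-tuple 'I_i] stands for (i_1, ..., i_k) with
   i_j = c_j + 1, so that [c_j] itself is the encoding of the letter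
   alpha_(i_j). Parts of a composition of i are at most i. *)
Definition parts_of (i k : nat) (c : k.-tuple 'I_i) : seq nat :=
  [seq (val m).+1 | m <- c].

Definition letters_of (i k : nat) (c : k.-tuple 'I_i) : word :=
  [seq val m | m <- c].

Definition gen_disp_poly (K : fieldType) (i : nat) (t : K) : {malg K[word]} :=
  if i is 0%N then << [::] >>
  else \sum_(1 <= k < i.+1)
         \sum_(c : k.-tuple 'I_i | sumn (parts_of c) == i)
            p_coef (parts_of c) t *: << rev (letters_of c) >>.

Definition disp_poly (K : fieldType) (i : nat) : {malg K[word]} :=
  gen_disp_poly i (i%:R : K).

(* Main.v *)
(* Let d_a remove a leading letter a (of weight a): it is a derivation of the
   shuffle product, and an element of K<A> is determined by its constant term
   and its images under all d_a.  Put E_n(x) := P~_n(.; x + n - 1) and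
   E(x) := sum_n E_n(x) z^n, so that d_a E(x) = x z^a E(x + a).  By induction on
   the weight, E(x + y) = E(x) E(y) (shuffle product of coefficients), so E
   behaves like a power x |-> E(1)^x; with S(x, y) := (z d/dz E(x)) E(y), also
   S(x, y) = x S(1, x + y - 1) and x S(1, x - 1) = z d/dz E(x).  With
   x = t - i + 1, the sum in (A) is the coefficient of z^i in
   S(1, x - 1) + E(x), and the sum in (B) is that of
   ((x + 1) / i) S(1, x) - E(x + 1) + E(x). *)
Require Import Defs.
From HB Require Import structures.
From mathcomp Require Import all_boot all_order all_fingroup all_algebra.
From mathcomp Require Import finmap monalg ring zify.
Set Implicit Arguments.
Unset Strict Implicit.
Unset Printing Implicit Defensive.

Import GRing.Theory.
Local Open Scope ring_scope.

(** * Linear extension of maps defined on words *)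

Section LinearExtension.
Variables (K : fieldType) (V : lmodType K) (h : word -> V).

Definition lext (f : {malg K[word]}) : V := \sum_(w <- msupp f) f@_w *: h w.

(** Words outside the support contribute zero; enlarging the range lets sums with different supports
    be compared over one common set. *)
Lemma lextEw (d : {fset word}) (f : {malg K[word]}) :
  (msupp f `<=` d)%fset -> lext f = \sum_(w <- d) f@_w *: h w.
Proof.
move=> sfd; apply: (big_fset_incl _ sfd) => w _ wNf.
by rewrite mcoeff_outdom // scale0r.
Qed.

Lemma lext_is_linear : linear lext.
Proof.
move=> c f g; pose d := (msupp f `|` msupp g `|` msupp (c *: f + g))%fset.
have sf : (msupp f `<=` d)%fset by apply/fsubsetP => w; rewrite !inE => ->.
have sg : (msupp g `<=` d)%fset
  by apply/fsubsetP => w; rewrite !inE => ->; rewrite orbT.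
have sfg : (msupp (c *: f + g) `<=` d)%fset
  by apply/fsubsetP => w; rewrite !inE => ->; rewrite !orbT.
rewrite (lextEw sf) (lextEw sg) (lextEw sfg) scaler_sumr -big_split /=.
by apply: eq_bigr => w _; rewrite mcoeffD mcoeffZ scalerDl scalerA.
Qed.

HB.instance Definition _ :=
  GRing.isLinear.Build K {malg K[word]} V *:%R lext lext_is_linear.

Lemma lextU (w : word) : lext << w >> = h w.
Proof. by rewrite /lext msuppU oner_eq0 big_seq_fset1 mcoeffUU scale1r. Qed.

End LinearExtension.

(** * Bilinearity of the shuffle product, and removal of a leading letter *)

Section Shuffle.
Variable K : fieldType.
Local Notation A := {malg K[word]}.
Implicit Types (f g : A) (u v w : word).

Lemma malg_lin_ind (P : A -> Prop) :
    P 0 -> (forall c w f, P f -> P (c *: << w >> + f)) -> forall f, P f.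
Proof.
move=> P0 PD f; rewrite [f]monalgE; elim/big_rec: _ => // w g _ /(PD f@_w w).
congr (P (_ + _)); apply/malgP => v.
by rewrite mcoeffZ !mcoeffU mulr_natr.
Qed.

(** Bilinearity of the shuffle is inherited from linearity of [lext] through this form. *)
Lemma shuffleE f g : f ⧢ g = lext (fun u => lext (shuffle_word K u) g) f.
Proof.
apply: eq_bigr => u _; rewrite scaler_sumr.
by apply: eq_bigr => v _; rewrite scalerA.
Qed.

Lemma shuffleDl f1 f2 g : (f1 + f2) ⧢ g = f1 ⧢ g + f2 ⧢ g.
Proof. by rewrite !shuffleE linearD. Qed.

Lemma shuffleZl c f g : (c *: f) ⧢ g = c *: (f ⧢ g).
Proof. by rewrite !shuffleE linearZ. Qed.

Lemma shuffle0l g : 0 ⧢ g = 0.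
Proof. by rewrite shuffleE linear0. Qed.

Lemma shuffle_linear_r c f g1 g2 : f ⧢ (c *: g1 + g2) = c *: (f ⧢ g1) + f ⧢ g2.
Proof.
rewrite !shuffleE ![lext _ f]/lext scaler_sumr -big_split.
apply: eq_bigr => u _ /=.
by rewrite linearP scalerDr !scalerA mulrC.
Qed.

Lemma shuffle0r f : f ⧢ 0 = 0.
Proof.
by rewrite shuffleE [lext _ f]/lext big1 // => u _; rewrite linear0 scaler0.
Qed.

Lemma shuffleZr c f g : f ⧢ (c *: g) = c *: (f ⧢ g).
Proof. by rewrite -[c *: g]addr0 shuffle_linear_r shuffle0r addr0. Qed.

Lemma shuffleUU u v : << u >> ⧢ << v >> = shuffle_word K u v.
Proof. by rewrite shuffleE !lextU. Qed.

Definition strip_letter (a : nat) (w : word) : A :=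
  if w is b :: w' then (if b == a then << w' >> else 0) else 0.

Definition lderiv (a : nat) : A -> A := lext (strip_letter a).
HB.instance Definition _ a := GRing.Linear.on (lderiv a).

Lemma lderivE a f w : (lderiv a f)@_w = f@_(a :: w).
Proof.
elim/malg_lin_ind: f => [|c u f IHf]; first by rewrite linear0 !mcoeff0.
rewrite linearP /= [lderiv a << u >>]lextU !mcoeffD !mcoeffZ IHf mcoeffU.
congr (_ * _ + _); case: u => [|b u] /=; first by rewrite mcoeff0.
rewrite eqseq_cons; case: eqP => _ /=; last by rewrite mcoeff0.
by rewrite mcoeffU.
Qed.

Lemma lderiv_ext f g :
  f@_[::] = g@_[::] -> (forall a, lderiv a f = lderiv a g) -> f = g.
Proof.
move=> fg0 fgD; apply/malgP => -[|a w] //.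
by rewrite -!lderivE fgD.
Qed.

End Shuffle.

(* [is_shuffle r q] with the total length n in place of r + q, so that removing
   a letter from the second word needs no cast along [addnS]. *)
Definition shufb n r (s : 'S_n) : bool :=
  [forall x : 'I_n, forall y : 'I_n,
     ((x < y < r)%N || (r <= x < y)%N) ==> ((s^-1)%g x < (s^-1)%g y)%N].

(** Splits a sum over permutations by the image of position 0, that is, by the source of the first
    letter. Injectivity suffices, since (n+1) n! = (n+1)!. *)
Lemma lift_perm0_bij n :
  bijective (fun p : 'I_n.+1 * 'S_n => lift_perm ord0 p.1 p.2).
Proof.
apply: inj_card_bij.
  move=> [j s] [j' s'] /= eq_ls.
  have jj' : j = j' by rewrite -(lift_perm_id ord0 j s) eq_ls lift_perm_id.
  rewrite -{}jj' {j'} in eq_ls *; congr pair; apply/permP => k.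
  by apply: (@lift_inj _ j); rewrite -!(lift_perm_lift ord0) eq_ls.
by rewrite card_prod card_ord !card_Sn.
Qed.

Lemma shufbP n r (s : 'S_n) :
  reflect (forall x y : 'I_n, (x < y < r)%N || (r <= x < y)%N ->
             ((s^-1)%g x < (s^-1)%g y)%N)
          (shufb r s).
Proof.
apply: (iffP 'forall_forallP) => /= sP x y; first exact/implyP/sP.
exact/implyP/sP.
Qed.

(** The first output letter must head one of the two blocks, at position 0 (if the first block is
    nonempty) or at [r]. Deleting it shortens the first block exactly when [j < r]. *)
Lemma shufb_lift n r (j : 'I_n.+1) (s : 'S_n) :
  shufb r (lift_perm ord0 j s) =
    ((j == 0 :> nat) && (0 < r) || (j == r :> nat))%N && shufb (r - (j < r)) s.
Proof.
apply/shufbP/andP => [sP | [j_first /shufbP sP] x y].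
  have j_first : ((j == 0 :> nat) && (0 < r) || (j == r :> nat))%N.
    (* Otherwise [j.-1] lies in the same block as [j], so its preimage would have to precede
       position 0. *)
    apply: contraT => j_nfirst; have j_gt0 : (0 < j)%N by lia.
    suff: ((lift_perm ord0 j s)^-1%g (inord j.-1) <
             (lift_perm ord0 j s)^-1%g j)%N.
      by rewrite lift_permV lift_perm_id.
    by apply: sP; rewrite inordK; have := ltn_ord j; lia.
  split=> //; apply/shufbP => x y xy; have := sP (lift j x) (lift j y).
  rewrite lift_permV !lift_perm_lift /= /bump; apply; lia.
rewrite lift_permV.
case: (unliftP j x) => [x' ->|->]; case: (unliftP j y) => [y' ->|->];
  rewrite ?lift_perm_lift ?lift_perm_id /= /bump.
- by move=> xy; rewrite !add1n ltnS; apply: sP; lia.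
- by move: j_first => /[swap]; lia.
- by [].
by rewrite ltnn; lia.
Qed.

(** * The Leibniz rule and the constant term of a shuffle *)

Section WordDerivation.
Variable K : fieldType.
Local Notation A := {malg K[word]}.
Implicit Types (u v w : word).

(** Here [w] plays the concatenation of both words and [r] the length of the first; deleting a
    letter of [w] stays within this family. *)
Definition shsum n r w : A :=
  \sum_(s : 'S_n | shufb r s) << [seq nth 0%N w (s k) | k : 'I_n] >>.

Lemma lderivU a b w :
  lderiv a << b :: w >> = if b == a then << w >> else 0 :> A.
Proof. exact: lextU. Qed.

Lemma nth_lift n w (j : 'I_n.+1) (k : 'I_n) : size w = n.+1 ->
  nth 0%N w (lift j k) = nth 0%N (take j w ++ drop j.+1 w) k.
Proof.
move=> sz_w; rewrite nth_cat size_take sz_w ltn_ord /= /bump.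
case: ltnP => kj; first by rewrite nth_take.
by rewrite nth_drop; congr nth; lia.
Qed.

(* The first letter of a shuffle comes from position 0 or from position r. *)
Lemma lderiv_shsum a n r w : size w = n.+1 ->
  lderiv a (shsum n.+1 r w) =
    \sum_(j < n.+1 | ((j == 0 :> nat) && (0 < r) || (j == r :> nat))%N)
      if nth 0%N w j == a then shsum n (r - (j < r)) (take j w ++ drop j.+1 w)
      else 0.
Proof.
move=> sz_w.
rewrite linear_sum (reindex _ (onW_bij _ (lift_perm0_bij n))) /=.
under eq_bigl => p do rewrite shufb_lift.
rewrite -(pair_big_dep
  (fun j : 'I_n.+1 => ((j == 0 :> nat) && (0 < r) || (j == r :> nat))%N)
  (fun j (s : 'S_n) => shufb (r - (j < r)) s)
  (fun j s => lderiv a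
     << [seq nth 0%N w (lift_perm ord0 j s k) | k : 'I_n.+1] >>)) /=.
apply: eq_bigr => j _.
have split_word (s : 'S_n) :
    [seq nth 0%N w (lift_perm ord0 j s k) | k : 'I_n.+1] =
    nth 0%N w j :: [seq nth 0%N (take j w ++ drop j.+1 w) (s k) | k : 'I_n].
  rewrite /image_mem enum_ordSl /= lift_perm_id -map_comp; congr cons.
  by apply: eq_map => k /=; rewrite lift_perm_lift nth_lift.
under eq_bigr => s _ do rewrite split_word lderivU.
by case: eqP => // _; rewrite big1.
Qed.

Lemma shuffle_wordE u v :
  shuffle_word K u v = shsum (size u + size v) (size u) (u ++ v).
Proof. by []. Qed.

Lemma shsum_cast n m r w : n = m -> shsum n r w = shsum m r w.
Proof. by move->. Qed.

Lemma lderiv_nil a : lderiv a << [::] >> = 0 :> A.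
Proof. exact: lextU. Qed.

(** The two possible sources of the first letter, the heads of [u] and [v], give the two terms of
    the Leibniz rule. *)
Lemma lderiv_shuffle_word a u v :
  lderiv a (shuffle_word K u v) =
    (lderiv a << u >> ⧢ << v >>) + (<< u >> ⧢ lderiv a << v >>).
Proof.
rewrite shuffle_wordE; case: u => [|b u].
  rewrite lderiv_nil shuffle0l add0r; case: v => [|c v].
    rewrite lderiv_nil shuffle0r linear_sum big1 // => s _ /=.
    by rewrite /image_mem enum_ord0 lderiv_nil.
  (* With an empty first word [r] is 0, so only one candidate position remains. *)
  rewrite lderiv_shsum // (eq_bigl (fun j : 'I__ => j == 0 :> nat)); last first.
    by move=> j; rewrite andbF.
  rewrite (big_ord1_eq _ (fun j => if nth 0%N (c :: v) j == a then
    shsum (size v) (0 - (j < 0)) (take j (c :: v) ++ drop j.+1 (c :: v))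
    else 0)).
  rewrite /= lderivU drop0; case: eqP => _; last by rewrite shuffle0r.
  by rewrite shuffleUU.
rewrite lderiv_shsum /= ?size_cat // big_mkcond big_ord_recl /= drop0 subn1.
rewrite lderivU; congr (_ + _).
  by case: eqP => _; rewrite ?shuffleUU ?shuffle0l.
(* The position-0 term has been split off; [G] is the summand at position [j.+1] of [b :: u ++ v],
   nonzero only for the head of [v]. *)
pose G j : A := if nth 0%N (u ++ v) j == a then
  shsum (size u + size v) ((size u).+1 - (j < size u))
    (b :: take j (u ++ v) ++ drop j.+1 (u ++ v)) else 0.
transitivity (\sum_(j < size u + size v | j == size u :> nat) G j).
  rewrite [RHS]big_mkcond; exact: eq_bigr.
case: v @G => [|c v] G.
  rewrite lderiv_nil shuffle0r big1 // => j /eqP ju.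
  by have := ltn_ord j; rewrite ju addn0 ltnn.
rewrite (big_ord1_eq _ G) addnS ltnS leq_addr /G.
rewrite nth_cat ltnn subnn /= take_size_cat // subn0 lderivU.
rewrite -cat_rcons drop_size_cat ?size_rcons //.
case: eqP => _; last by rewrite shuffle0r.
by rewrite shuffleUU; apply: shsum_cast; rewrite /= addSn addnS.
Qed.

Lemma lderiv_shuffle a (f g : A) :
  lderiv a (f ⧢ g) = (lderiv a f ⧢ g) + (f ⧢ lderiv a g).
Proof.
elim/malg_lin_ind: f => [|c u f IHf].
  by rewrite linear0 !shuffle0l linear0 addr0.
rewrite linearP /= !shuffleDl !shuffleZl linearP /= IHf addrACA -scalerDr.
suff -> : lderiv a (<< u >> ⧢ g) =
    (lderiv a << u >> ⧢ g) + (<< u >> ⧢ lderiv a g) by [].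
elim/malg_lin_ind: g {IHf} => [|d v g IHg].
  by rewrite linear0 !shuffle0r linear0 addr0.
rewrite linearP /= !shuffle_linear_r linearP /= IHg addrACA -scalerDr.
by rewrite shuffleUU lderiv_shuffle_word.
Qed.

(** Shuffling preserves total length, and the only permutation of the empty set is the identity. *)
Lemma mcoeff_shuffle_word_nil u v :
  (shuffle_word K u v)@_[::] = << u >>@_[::] * << v >>@_[::].
Proof.
rewrite shuffle_wordE raddf_sum !mcoeffU /= -natrM mulnb.
have [/andP[/nilP -> /nilP ->] | uvN] := boolP (nilp u && nilp v).
  rewrite (big_pred1 1%g) => [|s]; last first.
    apply/shufbP/eqP => [_|_ []//].
    by apply/permP => -[].
  by rewrite mcoeffU /image_mem enum_ord0 /=.
rewrite big1 => [|s _]; last first.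
  rewrite mcoeffU; case: eqP => // /(congr1 size)/eqP.
  by rewrite size_image card_ord addn_eq0 -/(nilp _) (negbTE uvN).
by move: uvN; case: u => //=; case: v.
Qed.

Lemma mcoeff_shuffle_nil (f g : A) : (f ⧢ g)@_[::] = f@_[::] * g@_[::].
Proof.
elim/malg_lin_ind: f => [|c u f IHf].
  by rewrite !shuffle0l !mcoeff0 mul0r.
rewrite shuffleDl shuffleZl !mcoeffD !mcoeffZ IHf mulrDl; congr (_ + _).
rewrite -mulrA; congr (_ * _); elim/malg_lin_ind: g {IHf} => [|d v g IHg].
  by rewrite !shuffle0r !mcoeff0 mulr0.
rewrite shuffle_linear_r !mcoeffD !mcoeffZ IHg mulrDr; congr (_ + _).
by rewrite shuffleUU mcoeff_shuffle_word_nil mulrCA.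
Qed.

End WordDerivation.

(** * Coefficients and derivatives of the displacement polynomials *)

Section DisplacementPolynomials.
Variable K : fieldType.
Local Notation A := {malg K[word]}.
Implicit Types (w : word) (t x y : K).

(** The successor accounts for letter [m] encoding alpha_(m+1). *)
Definition weight w : nat := sumn [seq m.+1 | m <- w].

Lemma weight_ge_size w : (size w <= weight w)%N.
Proof. by elim: w => //= m w; rewrite /weight /=; lia. Qed.

(** Guarantees that the letters of a word of weight n fit into ['I_n]. *)
Lemma ltn_weight w m : m \in w -> (m < weight w)%N.
Proof.
elim: w => //= l w IHw; rewrite inE /weight /= -/(weight w).
by case/predU1P => [->|/IHw]; lia.
Qed.

(** A word of weight n arises from exactly one composition of n, read off from its letters in
    reverse, so the double sum collapses. *)
Lemma mcoeff_gen_disp_poly n t w :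
  (gen_disp_poly n t)@_w =
    if weight w == n then p_coef (rev [seq m.+1 | m <- w]) t else 0.
Proof.
case: n => [|n] /=.
  rewrite mcoeffU; case: w => [|a w] //=.
  by rewrite /p_coef big_geq.
have inner k : (\sum_(c : k.-tuple 'I_n.+1 | sumn (parts_of c) == n.+1)
      p_coef (parts_of c) t *: << rev (letters_of c) >>)@_w =
    if (k == size w) && (weight w == n.+1)
      then p_coef (rev [seq m.+1 | m <- w]) t else 0.
  have parts_letters (c : k.-tuple 'I_n.+1) :
      parts_of c = [seq m.+1 | m <- letters_of c].
    by rewrite /parts_of /letters_of -map_comp.
  rewrite raddf_sum /=; case: ifP => [/andP[/eqP kw /eqP wn]|kwn].
    have c0P : size [seq (inord m : 'I_n.+1) | m <- rev w] == k.
      by rewrite size_map size_rev kw.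
    pose c0 := Tuple c0P.
    have c0E : letters_of c0 = rev w.
      rewrite /letters_of -map_comp -[RHS]map_id; apply/eq_in_map => m.
      by rewrite mem_rev => /ltn_weight; rewrite wn => mn; rewrite /= inordK.
    have c0s : sumn (parts_of c0) == n.+1.
      by rewrite parts_letters c0E map_rev sumn_rev -wn.
    rewrite (bigD1 c0) //= big1 ?addr0 => [|c /andP[_ cc0]].
      by rewrite mcoeffZ mcoeffU parts_letters c0E revK eqxx mulr1 map_rev.
    rewrite mcoeffZ mcoeffU; case: eqP => [cw|_]; last by rewrite mulr0.
    case/eqP: cc0; apply/val_inj/(inj_map val_inj).
    by rewrite -[LHS]/(letters_of c) -[RHS]/(letters_of c0) c0E -cw revK.
  rewrite big1 // => c /eqP cn; rewrite mcoeffZ mcoeffU.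
  case: eqP => [cw|_]; last by rewrite mulr0.
  case/andP: kwn; rewrite -{1}cw size_rev size_map size_tuple eqxx; split=> //.
  by rewrite -cw /weight map_rev sumn_rev -parts_letters cn.
rewrite raddf_sum /=; under eq_bigr => k _ do rewrite inner.
case: (weight w =P n.+1) => [wn|_]; last first.
  by rewrite big1 // => k _; rewrite andbF.
under eq_bigr => k _ do rewrite andbT.
have w_gt0 : (0 < size w)%N by case: w wn {inner}.
rewrite (bigD1_seq (size w)) ?iota_uniq //=; last first.
  by rewrite mem_index_iota w_gt0 ltnS -wn weight_ge_size.
by rewrite eqxx big1 ?addr0 // => k /negbTE ->.
Qed.

(** Each factor depends only on a prefix of the parts, so a new last part affects only the new
    factor. *)
Lemma p_coef_rcons s k t :
  p_coef (rcons s k) t = p_coef s t * (t - (sumn s + k)%:R + 1).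
Proof.
rewrite /p_coef size_rcons big_nat_recr //= -cats1 take_oversize; last first.
  by rewrite size_cat addn1.
rewrite sumn_cat /= addn0; congr (_ * _); apply: eq_big_nat => m /andP[_ ms].
by rewrite takel_cat // -ltnS.
Qed.

(** Multiplication of the series sum_n f_n z^n by z^(a+1), the weight of letter [a]. *)
Definition delay (V : nmodType) (a : nat) (f : nat -> V) (n : nat) : V :=
  if (a < n)%N then f (n - a.+1)%N else 0.

(** The leading letter is the last part of the composition; its factor involves the full sum n and
    is therefore the same for every word. *)
Lemma lderiv_gen_disp_poly a n t :
  lderiv a (gen_disp_poly n t) =
    delay a (fun m => (t - n%:R + 1) *: gen_disp_poly m t) n.
Proof.
apply/malgP => w; rewrite lderivE mcoeff_gen_disp_poly /weight /= -/(weight w).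
rewrite /delay rev_cons; case: ltnP => an; last first.
  by rewrite mcoeff0; case: eqP => //; lia.
rewrite mcoeffZ mcoeff_gen_disp_poly p_coef_rcons sumn_rev -/(weight w).
have -> : (a.+1 + weight w == n)%N = (weight w == n - a.+1)%N by lia.
case: eqP => [wn|_]; last by rewrite mulr0.
by rewrite mulrC; congr ((_ - _%:R + _) * _); lia.
Qed.

End DisplacementPolynomials.

(** * Generating series over the shuffle algebra, [sconv] being their Cauchy product *)

Definition sconv (K : fieldType) (f g : nat -> {malg K[word]}) (n : nat) :=
  \sum_(0 <= l < n.+1) (f l ⧢ g (n - l)%N).

(* E_n(x): the shift x + n - 1 makes d_a act by a factor x independent of n. *)
HB.lock Definition Epoly (K : fieldType) (x : K) (n : nat) : {malg K[word]} :=
  gen_disp_poly n (x + n%:R - 1).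

(* The coefficient of z^n in S(x, y) = (z d/dz E(x)) E(y). *)
HB.lock Definition wsconv (K : fieldType) (x y : K) (n : nat) :
    {malg K[word]} :=
  sconv (fun l => l%:R *: Epoly x l) (Epoly y) n.

Section Convolution.
Variable K : fieldType.
Local Notation A := {malg K[word]}.
Implicit Types (f g : nat -> A) (x y t : K).

Lemma sconv_delayl a f g n : sconv (delay a f) g n = delay a (sconv f g) n.
Proof.
rewrite /delay /sconv; case: ltnP => an; last first.
  rewrite big_nat big1 // => l /andP[_ ln].
  by case: ltnP => [|_]; [lia | rewrite shuffle0l].
rewrite (@big_cat_nat _ _ _ a.+1) //=; last lia.
rewrite big_nat big1 ?add0r => [|l /andP[_ la]]; last first.
  by case: ltnP => [|_]; [lia | rewrite shuffle0l].
rewrite -[a.+1 in LHS]add0n big_addn subSn //; apply: eq_bigr => l _.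
by rewrite addnK leq_addl; congr (_ ⧢ g _); lia.
Qed.

Lemma sconv_delayr a f g n : sconv f (delay a g) n = delay a (sconv f g) n.
Proof.
rewrite /delay /sconv; case: ltnP => an; last first.
  rewrite big_nat big1 // => l /andP[_ ln].
  by case: ltnP => [|_]; [lia | rewrite shuffle0r].
rewrite (@big_cat_nat _ _ _ (n - a.+1).+1) //=; last lia.
rewrite addrC big_nat big1 ?add0r => [|l /andP[la ln]]; last first.
  by case: ltnP => [|_]; [lia | rewrite shuffle0r].
apply: eq_big_nat => l /andP[_ la]; case: ltnP => [_|]; last lia.
by congr (_ ⧢ g _); lia.
Qed.

Lemma lderiv_sconv a f g n :
  lderiv a (sconv f g n) =
    sconv (fun l => lderiv a (f l)) g n + sconv f (fun l => lderiv a (g l)) n.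
Proof.
by rewrite linear_sum -big_split; apply: eq_bigr => l _; apply: lderiv_shuffle.
Qed.

Lemma eq_sconv f1 f2 g1 g2 n :
  f1 =1 f2 -> g1 =1 g2 -> sconv f1 g1 n = sconv f2 g2 n.
Proof. by move=> f12 g12; apply: eq_bigr => l _; rewrite f12 g12. Qed.

Lemma sconvZl c f g n : sconv (fun l => c *: f l) g n = c *: sconv f g n.
Proof. by rewrite scaler_sumr; apply: eq_bigr => l _; rewrite shuffleZl. Qed.

Lemma sconvZr c f g n : sconv f (fun l => c *: g l) n = c *: sconv f g n.
Proof. by rewrite scaler_sumr; apply: eq_bigr => l _; rewrite shuffleZr. Qed.

Lemma sconvDZl c f1 f2 g n :
  sconv (fun l => f1 l + c *: f2 l) g n = sconv f1 g n + c *: sconv f2 g n.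
Proof.
rewrite scaler_sumr -big_split; apply: eq_bigr => l _ /=.
by rewrite shuffleDl shuffleZl.
Qed.

Lemma mcoeff_sconv_nil f g n :
  (sconv f g n)@_[::] = \sum_(0 <= l < n.+1) (f l)@_[::] * (g (n - l)%N)@_[::].
Proof.
by rewrite raddf_sum; apply: eq_bigr => l _; apply: mcoeff_shuffle_nil.
Qed.

Lemma mcoeff_Epoly_nil x n : (Epoly x n)@_[::] = (n == 0%N)%:R.
Proof.
rewrite unlock mcoeff_gen_disp_poly /weight /= eq_sym.
by case: eqP => // _; rewrite /p_coef big_geq.
Qed.

(** Removing letter [a] lowers n by a+1 at fixed t = x + n - 1, which raises x by a+1. *)
Lemma lderiv_Epoly a x n :
  lderiv a (Epoly x n) = x *: delay a (Epoly (x + a.+1%:R)) n.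
Proof.
rewrite unlock lderiv_gen_disp_poly /delay.
case: ltnP => an; last by rewrite scaler0.
rewrite (natrB _ an).
have -> : x + n%:R - 1 - n%:R + 1 = x by ring.
by have -> : x + a.+1%:R + (n%:R - a.+1%:R) - 1 = x + n%:R - 1 by ring.
Qed.

(** By the Leibniz rule and induction, the two terms for the product are x and y times the same
    delayed E(x + y + a + 1). *)
Lemma Epoly_add x y n : Epoly (x + y) n = sconv (Epoly x) (Epoly y) n.
Proof.
elim/ltn_ind: n x y => n IHn x y; apply: lderiv_ext => [|a].
  rewrite mcoeff_Epoly_nil mcoeff_sconv_nil big_nat_recl // subn0.
  rewrite !mcoeff_Epoly_nil big1 ?addr0 ?mul1r // => l _.
  by rewrite mcoeff_Epoly_nil mul0r.
rewrite lderiv_Epoly lderiv_sconv.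
rewrite (eq_sconv _ (lderiv_Epoly a x) (frefl _)) sconvZl sconv_delayl.
rewrite (eq_sconv _ (frefl _) (lderiv_Epoly a y)) sconvZr sconv_delayr.
rewrite /delay; case: ltnP => an; last by rewrite !scaler0 addr0.
rewrite -!IHn; [|lia..].
have -> : x + a.+1%:R + y = x + y + a.+1%:R by ring.
by rewrite addrA -scalerDl.
Qed.

(** The [Epoly] term comes from z d/dz hitting z^(a+1): the weight l splits as (l - a - 1) + (a +
    1). *)
Lemma lderiv_wsconv a x y n :
  lderiv a (wsconv x y n) =
    delay a (fun m =>
      x *: (wsconv (x + a.+1%:R) y m + a.+1%:R *: Epoly (x + y + a.+1%:R) m)
      + y *: wsconv x (y + a.+1%:R) m) n.
Proof.
rewrite wsconv.unlock lderiv_sconv.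
have Dl l : lderiv a (l%:R *: Epoly x l) =
    x *: delay a (fun m => m%:R *: Epoly (x + a.+1%:R) m
                     + a.+1%:R *: Epoly (x + a.+1%:R) m) l.
  rewrite linearZ /= lderiv_Epoly /delay; case: ltnP => al.
    rewrite -scalerDl -natrD (subnK al) !scalerA mulrC; reflexivity.
  by rewrite !scaler0.
rewrite (eq_sconv _ Dl (frefl _)) sconvZl sconv_delayl.
rewrite (eq_sconv _ (frefl _) (lderiv_Epoly a y)) sconvZr sconv_delayr.
rewrite /delay; case: ltnP => an; last by rewrite !scaler0 addr0.
rewrite sconvDZl -(Epoly_add (x + a.+1%:R) y).
by have -> : x + a.+1%:R + y = x + y + a.+1%:R by ring.
Qed.

Lemma mcoeff_wsconv_nil x y n : (wsconv x y n)@_[::] = 0.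
Proof.
rewrite wsconv.unlock mcoeff_sconv_nil big1 // => l _.
rewrite mcoeffZ !mcoeff_Epoly_nil.
by case: (l =P 0%N) => [->|_]; rewrite /= ?mulr0n ?mulr0 !mul0r.
Qed.

(** The power rule: if E(x) = E(1)^x, then z d/dz E(x) = x E(1)^(x-1) (z d/dz E(1)). *)
Lemma wsconv_scale x y n : wsconv x y n = x *: wsconv 1 (x + y - 1) n.
Proof.
elim/ltn_ind: n x y => n IHn x y; apply: lderiv_ext => [|a].
  by rewrite mcoeffZ !mcoeff_wsconv_nil mulr0.
rewrite linearZ /= !lderiv_wsconv /delay; case: ltnP => an; last first.
  by rewrite scaler0.
have mn : (n - a.+1 < n)%N by lia.
(* Every lower term becomes a multiple of S(1, x + y + a), leaving a comparison of scalars. *)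
rewrite (IHn _ mn (x + _)) (IHn _ mn x) (IHn _ mn (1 + _)) (IHn _ mn 1) scale1r.
have -> : x + a.+1%:R + y - 1 = x + y - 1 + a.+1%:R by ring.
have -> : x + (y + a.+1%:R) - 1 = x + y - 1 + a.+1%:R by ring.
have -> : 1 + a.+1%:R + (x + y - 1) - 1 = x + y - 1 + a.+1%:R by ring.
have -> : 1 + (x + y - 1 + a.+1%:R) - 1 = x + y - 1 + a.+1%:R by ring.
have -> : 1 + (x + y - 1) + a.+1%:R = x + y + a.+1%:R by ring.
rewrite !scalerDr !scalerA addrAC -scalerDl [RHS]addrAC -scalerDl !mul1r mulr1.
have -> // : x * (x + a.+1%:R) + y * x =
  x * (1 + a.+1%:R) + x * (x + y - 1) by ring.
Qed.

Lemma scale_wsconv x n : x *: wsconv 1 (x - 1) n = n%:R *: Epoly x n.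
Proof.
elim/ltn_ind: n x => n IHn x; apply: lderiv_ext => [|a].
  rewrite !mcoeffZ mcoeff_wsconv_nil mcoeff_Epoly_nil mulr0.
  by case: (n =P 0%N) => [->|_]; rewrite /= ?mulr0n ?mul0r ?mulr0.
rewrite !linearZ /= lderiv_wsconv lderiv_Epoly /delay.
case: ltnP => an; last by rewrite !scaler0.
have mn : (n - a.+1 < n)%N by lia.
rewrite wsconv_scale.
have -> : 1 + a.+1%:R + (x - 1) - 1 = x + a.+1%:R - 1 by ring.
have -> : x - 1 + a.+1%:R = x + a.+1%:R - 1 by ring.
have -> : 1 + (x - 1) + a.+1%:R = x + a.+1%:R by ring.
rewrite scale1r addrAC -scalerDl.
have -> : 1 + a.+1%:R + (x - 1) = x + a.+1%:R by ring.
(* Induction at x + a + 1 yields the weight n - a - 1, and the extra [Epoly] term restores n. *)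
by rewrite IHn // -scalerDl !scalerA -natrD subnK // mulrC.
Qed.

End Convolution.

(** Each [lderiv a] kills the empty word, so the Leibniz rule reduces the claim to a shorter
    word. *)
Lemma shuffle1l (K : fieldType) (f : {malg K[word]}) : << [::] >> ⧢ f = f.
Proof.
elim/malg_lin_ind: f => [|c w f IHf]; first by rewrite shuffle0r.
rewrite shuffle_linear_r IHf; congr (_ + _).
suff -> : << [::] >> ⧢ << w >> = << w >> :> {malg K[word]} by [].
elim: w {f IHf} => [|b w IHw]; apply: lderiv_ext => [|a].
- by rewrite mcoeff_shuffle_nil mcoeffUU mul1r.
- by rewrite lderiv_shuffle lderiv_nil shuffle0l shuffle0r addr0.
- by rewrite mcoeff_shuffle_nil mcoeffUU mul1r.
rewrite lderiv_shuffle lderiv_nil shuffle0l add0r lderivU.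
by case: eqP => _; rewrite ?shuffle0r.
Qed.

Lemma gen_disp_polyE (K : fieldType) n (t x : K) :
  t = x + n%:R - 1 -> gen_disp_poly n t = Epoly x n.
Proof. by move=> ->; rewrite Epoly.unlock. Qed.

Lemma disp_polyE (K : fieldType) n : disp_poly K n = Epoly 1 n.
Proof. by apply: gen_disp_polyE; ring. Qed.

Theorem theorem6p9 (K : fieldType) (charK : [pchar K] =i pred0)
    (i : nat) (i_gt0 : (0 < i)%N) :
  (forall t : K, t != -1 ->
     gen_disp_poly i t =
       ((t - i%:R + 1) / (t + 1)) *:
         \sum_(1 <= j < i.+2)
            j%:R *: (disp_poly K j.-1 ⧢ gen_disp_poly (i.+1 - j) (t - j%:R)))
  /\
  (forall t : K,
     gen_disp_poly i t =
       \sum_(1 <= j < i.+1)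
          ((t - i%:R + 2) * j%:R / i%:R - 1) *:
            (disp_poly K j ⧢ gen_disp_poly (i - j) (t - j%:R))).
Proof.
have i_neq0 : i%:R != 0 :> K by rewrite ((pcharf0P K).1 charK) -lt0n.
(* This x solves t = x + i - 1. The second shuffle factors then have parameter x - 1 in (A), where
   index and argument sum to t + i + 1 - 2j, and x in (B). *)
split=> [t t_neqN1 | t]; pose x := t - i%:R + 1;
  rewrite (@gen_disp_polyE _ _ _ x); try by rewrite /x; ring.
- have t1_neq0 : t + 1 != 0 by rewrite addr_eq0.
  have -> : \sum_(1 <= j < i.+2)
      j%:R *: (disp_poly K j.-1 ⧢ gen_disp_poly (i.+1 - j) (t - j%:R)) =
      wsconv 1 (x - 1) i + sconv (Epoly 1) (Epoly (x - 1)) i.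
    (* With j = l + 1, the part l of the weight gives [wsconv] and the part 1 gives [sconv]. *)
    rewrite wsconv.unlock -big_split big_add1 /=.
    apply: eq_big_nat => l /andP[_ li].
    rewrite subSS disp_polyE shuffleZl.
    rewrite (@gen_disp_polyE _ _ _ (x - 1)); last by rewrite /x natrB //; ring.
    by rewrite -[l.+1%:R]/(1 *+ l.+1) mulrSr scalerDl scale1r.
  (* Multiplying by x turns the sum into (i + x) E(x), and i + x = t + 1. *)
  rewrite -Epoly_add mulrC -scalerA scalerDr scale_wsconv.
  have -> : 1 + (x - 1) = x by ring.
  rewrite -scalerDl scalerA; have -> : i%:R + x = t + 1 by rewrite /x; ring.
  by rewrite mulVf // scale1r.
have -> : \sum_(1 <= j < i.+1) ((t - i%:R + 2) * j%:R / i%:R - 1) *: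
      (disp_poly K j ⧢ gen_disp_poly (i - j) (t - j%:R)) =
    ((x + 1) / i%:R) *: wsconv 1 x i
      - \sum_(1 <= j < i.+1) (Epoly 1 j ⧢ Epoly x (i - j)).
  (* The term of index 0, absent on the left, has weight zero. *)
  rewrite wsconv.unlock /sconv [in RHS]big_ltn // scale0r shuffle0l add0r.
  rewrite scaler_sumr -sumrB; apply: eq_big_nat => j /andP[_ ji].
  rewrite disp_polyE (@gen_disp_polyE _ _ _ x); last first.
    by rewrite /x natrB //; ring.
  rewrite scalerBl scale1r shuffleZl scalerA /x.
  have -> // : (t - i%:R + 1 + 1) / i%:R * j%:R =
    (t - i%:R + 2) * j%:R / i%:R by ring.
have -> : \sum_(1 <= j < i.+1) (Epoly 1 j ⧢ Epoly x (i - j)) =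
    Epoly (1 + x) i - Epoly x i.
  have E10 : Epoly (1 : K) 0 = << [::] >> by rewrite Epoly.unlock.
  rewrite Epoly_add /sconv [in RHS]big_ltn // E10 shuffle1l subn0.
  by rewrite addrC addKr.
(* In this form (1 + x) S(1, x) is i times E(1 + x), which cancels the subtracted E(1 + x). *)
have -> : wsconv 1 x i = wsconv 1 ((1 + x) - 1) i by rewrite [1 + x]addrC addrK.
rewrite mulrC -scalerA [x + 1]addrC scale_wsconv scalerA mulVf // scale1r.
by rewrite subKr.
Qed.
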